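(* Let $u$ be the exact solution of the interface problem and $R_{i,j}=L_hu(x_i,y_j)-h^2f(x_i,y_j)$, $(i,j)\in S_0$, the local truncation error of the five-point scheme, as described in the context. Let $u\in W$ and suppose that $\kappa^*=\frac{2\kappa^-}{\kappa^-+1}$ and that $$\lim_{x\to(1/2)^-}\frac{\partial^2u}{\partial y^2}(x,y)=\lim_{x\to(1/2)^+}\frac{\partial^2u}{\partial y^2}(x,y)=0\quad\text{for all }y.$$ Then $$R_{i,j}=\tilde C_i^{(2)}(y_j)h^2+C_i^{(3)}(y_j)h^3+O(h^4),\qquad (i,j)\in S_B=S_1^B\cup S_2^B,$$ where $$\tilde C_M^{(2)}(y)=\frac{\kappa^*}8\Big[\frac{\partial^2u}{\partial x^2}\Big](y),\qquad \tilde C_{M+1}^{(2)}(y)=-\tilde C_M^{(2)}(y),$$ $$C_M^{(3)}(y)=\Big(\frac{\kappa^-}{24}\Big(\frac{\partial^3u}{\partial x^3}\Big)^--\frac{\kappa^*}{24}\Big\{\frac{\partial^3u}{\partial x^3}\Big\}+\frac14\Big(\kappa^-\Big(\frac{\partial^3u}{\partial y^2\partial x}\Big)^--\kappa^*\Big(\frac{\partial^3u}{\partial y^2\partial x}\Big)^+\Big)\Big)(y),$$ $$C_{M+1}^{(3)}(y)=\Big(-\frac1{24}\Big(\frac{\partial^3u}{\partial x^3}\Big)^++\frac{\kappa^*}{24}\Big\{\frac{\partial^3u}{\partial x^3}\Big\}+\frac14\Big(-\Big(\frac{\partial^3u}{\partial y^2\partial x}\Big)^++\kappa^*\Big(\frac{\partial^3u}{\partial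 y^2\partial x}\Big)^-\Big)\Big)(y).$$ Here $(\zeta)^\pm(y)=\lim_{x\to(1/2)^\pm}\zeta(x,y)$, $[\zeta]=(\zeta)^--(\zeta)^+$ and $\{\zeta\}=\frac12((\zeta)^-+(\zeta)^+)$.
   Context: Interface problem. $\Omega=(0,1)\times(0,1)$, $D_1=(0,\frac12)\times(0,1)$, $D_2=(\frac12,1)\times(0,1)$, $\Gamma=\{x=\frac12\}$ is the interface. $\kappa=\kappa^-$ in $D_1$ with a constant $\kappa^-\ge 1$, and $\kappa=1$ in $D_2$. The exact solution $u$ satisfies $-\nabla\cdot(\kappa\nabla u)+u=f$ in $\Omega$ (in $D_1$ and in $D_2$), $u=0$ on $\partial\Omega$, and $[u]=[\kappa\,\partial u/\partial \vec n]=0$ on $\Gamma$, where $[\cdot]$ is the jump across $\Gamma$ and $\vec n$ is the unit normal to $\Gamma$. $W=\{w:\ w|_{\bar D_i}\in C^6(\bar D_i),\ i=1,2\}$. Grid. $N=2M+1$ with $M$ a positive integer, $h=1/N$, $x_i=ih$, $y_j=jh$ ($0\le i,j\le N$), so $\Gamma$ is the line $x=x_M+\frac h2$. $S_1^I=\{(i,j):1\le i\le M-1,1\le j\le N-1\}$, $S_2^I=\{(i,j):M+2\le i\le N-1,1\le j\le N-1\}$, $S_1^B=\{(M,j):1\le j\le N-1\}$, $S_2^B=\{(M+1,j):1\le j\le N-1\}$, $S_0=\{1,\dots,N-1\}^2$. Scheme operator. For a grid function $v$, $$L_hv_{i,j}=a_1^{i,j}v_{i-1,j-1}+a_2^{i,j}v_{i+1,j-1}+a_3^{i,j}v_{i,j}+a_4^{i,j}v_{i-1,j+1}+a_5^{i,j}v_{i+1,j+1},$$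 with: on $S_1^I$: $a_1=a_2=a_4=a_5=-\frac12\kappa^-$, $a_3=2\kappa^-+h^2$; on $S_1^B$: $a_1=a_4=-\frac12\kappa^-$, $a_2=a_5=-\frac12\kappa^*$, $a_3=\kappa^-+\kappa^*+h^2$; on $S_2^B$: $a_1=a_4=-\frac12\kappa^*$, $a_2=a_5=-\frac12$, $a_3=\kappa^*+1+h^2$; on $S_2^I$: $a_1=a_2=a_4=a_5=-\frac12$, $a_3=2+h^2$. $L_hu(x_i,y_j)$ means $L_h$ applied to the grid function $(u(x_i,y_j))$. The constants in the $O(\cdot)$ terms are independent of $h,i,j$ (they may depend on $u,\kappa^-$). *)

(* Defs.v *)
From Stdlib Require Import Reals Arith Bool.
From Coquelicot Require Import Coquelicot.
Open Scope R_scope.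

Definition bdOmega (x y : R) : Prop :=
  0 <= x <= 1 /\ 0 <= y <= 1 /\ (x = 0 \/ x = 1 \/ y = 0 \/ y = 1).

Definition D1 (x y : R) : Prop := 0 < x < 1 / 2 /\ 0 < y < 1.
Definition D2 (x y : R) : Prop := 1 / 2 < x < 1 /\ 0 < y < 1.
Definition D1bar (x y : R) : Prop := 0 <= x <= 1 / 2 /\ 0 <= y <= 1.
Definition D2bar (x y : R) : Prop := 1 / 2 <= x <= 1 /\ 0 <= y <= 1.

(* [w] has a limit [l] at [(x, y)] along the set [D]. *)
Definition lim_in (D : R -> R -> Prop) (w : R -> R -> R) (x y l : R) : Prop :=
  filterlim (fun p : R * R => w (fst p) (snd p))
    (within (fun p : R * R => D (fst p) (snd p)) (locally (x, y)))
    (locally l).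

(* [w] restricted to [Dbar] is in C^k(Dbar), [Dbar] being the closure of the
   open set [D]: [w] is C^k in [D], is continuous on [Dbar], and its partial
   derivatives of order at most [k] extend continuously from [D] to [Dbar].
   Values of [w] outside [Dbar] are irrelevant.  In [D] the order in which mixed
   derivatives are taken does not matter. *)
Definition Ck_closure (k : nat) (D Dbar : R -> R -> Prop) (w : R -> R -> R)
  : Prop :=
  (forall x y, D x y -> ex_diff_n w k x y) /\
  (forall x y, Dbar x y -> lim_in D w x y (w x y)) /\
  (forall m n x y, (m + n <= k)%nat -> Dbar x y ->
     exists l, lim_in D (partial_derive m n w) x y l).

Definition W (w : R -> R -> R) : Prop :=
  Ck_closure 6 D1 D1bar w /\ Ck_closure 6 D2 D2bar w.

(* One-sided limits at the interface x = 1/2.  As with [RInt], the total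
   functions [tr_l] and [tr_r] return the limit whenever it exists. *)
Definition is_tr_l (z : R -> R -> R) (y l : R) : Prop :=
  filterlim (fun x => z x y) (at_left (1 / 2)) (locally l).
Definition is_tr_r (z : R -> R -> R) (y l : R) : Prop :=
  filterlim (fun x => z x y) (at_right (1 / 2)) (locally l).
Definition tr_l (z : R -> R -> R) (y : R) : R := iota (fun l => is_tr_l z y l).
Definition tr_r (z : R -> R -> R) (y : R) : R := iota (fun l => is_tr_r z y l).

Definition jump (z : R -> R -> R) (y : R) : R := tr_l z y - tr_r z y.
Definition mean (z : R -> R -> R) (y : R) : R := (tr_l z y + tr_r z y) / 2.

(* The value on the interface itself is immaterial. *)
Definition kappa (km x y : R) : R := if Rlt_dec x (1 / 2) then km else 1.

Definition div_kappa_grad (km : R) (u : R -> R -> R) (x y : R) : R :=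
  partial_derive 1 0 (fun s t => kappa km s t * partial_derive 1 0 u s t) x y +
  partial_derive 0 1 (fun s t => kappa km s t * partial_derive 0 1 u s t) x y.

(* The unit normal to the interface is (1, 0). *)
Definition exact_solution (km : R) (f u : R -> R -> R) : Prop :=
  (forall x y, D1 x y \/ D2 x y -> - div_kappa_grad km u x y + u x y = f x y) /\
  (forall x y, bdOmega x y -> u x y = 0) /\
  (forall y, 0 < y < 1 ->
     jump u y = 0 /\
     jump (fun s t => kappa km s t * partial_derive 1 0 u s t) y = 0).

Definition gridN (M : nat) : nat := (2 * M + 1)%nat.
Definition gridh (M : nat) : R := / INR (gridN M).
(* Both x_k and y_k. *)
Definition node (M k : nat) : R := INR k * gridh M.

Definition between (a k b : nat) : bool := ((a <=? k) && (k <=? b))%nat.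
Definition S1I (M i j : nat) : bool :=
  between 1 i (M - 1) && between 1 j (gridN M - 1).
Definition S2I (M i j : nat) : bool :=
  between (M + 2) i (gridN M - 1) && between 1 j (gridN M - 1).
Definition S1B (M i j : nat) : bool :=
  (i =? M)%nat && between 1 j (gridN M - 1).
Definition S2B (M i j : nat) : bool :=
  (i =? M + 1)%nat && between 1 j (gridN M - 1).
Definition SB (M i j : nat) : bool := S1B M i j || S2B M i j.

Record stencil : Type :=
  Stencil { a1 : R; a2 : R; a3 : R; a4 : R; a5 : R }.

(* The final branch, outside the interior nodes, is never used. *)
Definition coeffs (km ks : R) (M i j : nat) : stencil :=
  let h := gridh M in
  if S1I M i j then
    Stencil (- (1/2) * km) (- (1/2) * km) (2 * km + h ^ 2)
            (- (1/2) * km) (- (1/2) * km)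
  else if S1B M i j then
    Stencil (- (1/2) * km) (- (1/2) * ks) (km + ks + h ^ 2)
            (- (1/2) * km) (- (1/2) * ks)
  else if S2B M i j then
    Stencil (- (1/2) * ks) (- (1/2)) (ks + 1 + h ^ 2)
            (- (1/2) * ks) (- (1/2))
  else if S2I M i j then
    Stencil (- (1/2)) (- (1/2)) (2 + h ^ 2) (- (1/2)) (- (1/2))
  else Stencil 0 0 0 0 0.

Definition Lh (km ks : R) (M : nat) (v : nat -> nat -> R) (i j : nat) : R :=
  let a := coeffs km ks M i j in
  a1 a * v (i - 1)%nat (j - 1)%nat + a2 a * v (i + 1)%nat (j - 1)%nat +
  a3 a * v i j +
  a4 a * v (i - 1)%nat (j + 1)%nat + a5 a * v (i + 1)%nat (j + 1)%nat.

Definition trunc_err (km ks : R) (f u : R -> R -> R) (M i j : nat) : R :=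
  Lh km ks M (fun k l => u (node M k) (node M l)) i j
  - gridh M ^ 2 * f (node M i) (node M j).

(* The subscripts [_M] and [_M1] stand for the grid columns i = M and
   i = M + 1; the functions themselves do not depend on the grid. *)
Definition C2_M (ks : R) (u : R -> R -> R) (y : R) : R :=
  ks / 8 * jump (partial_derive 2 0 u) y.
Definition C2_M1 (ks : R) (u : R -> R -> R) (y : R) : R := - C2_M ks u y.

Definition C3_M (km ks : R) (u : R -> R -> R) (y : R) : R :=
  km / 24 * tr_l (partial_derive 3 0 u) y
  - ks / 24 * mean (partial_derive 3 0 u) y
  + 1 / 4 * (km * tr_l (partial_derive 1 2 u) y
             - ks * tr_r (partial_derive 1 2 u) y).
Definition C3_M1 (km ks : R) (u : R -> R -> R) (y : R) : R :=
  - (1 / 24) * tr_r (partial_derive 3 0 u) y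
  + ks / 24 * mean (partial_derive 3 0 u) y
  + 1 / 4 * (- tr_r (partial_derive 1 2 u) y
             + ks * tr_l (partial_derive 1 2 u) y).

Definition C2 (ks : R) (u : R -> R -> R) (M i : nat) (y : R) : R :=
  if (i =? M)%nat then C2_M ks u y else C2_M1 ks u y.
Definition C3 (km ks : R) (u : R -> R -> R) (M i : nat) (y : R) : R :=
  if (i =? M)%nat then C3_M km ks u y else C3_M1 km ks u y.

(* Main.v *)
Require Import Defs.
From Stdlib Require Import Reals Lra Lia Bool Classical ClassicalEpsilon.
From Coquelicot Require Import Coquelicot.
Open Scope R_scope.

(** Put h for the mesh size and y = y_j.  A node next to the interface has its
    five stencil points at signed distances 3h/2, h/2 from x = 1/2 on its own
    side and h/2 on the other side, so the truncation error is computed by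
    Taylor expansion at the point (1/2, y), from each side separately:

      u(x, y+s) + u(x, y-s) = 2 (u + a u_x + a^2/2 u_xx + a^3/6 u_xxx)
                              + s^2 (u_yy + a u_xyy) + O(a^4 + s^4),

    where a = x - 1/2 and the derivatives are the traces from the side of x;
    the odd y-derivatives cancel in the pair.  The source term is minus the
    coefficient times u_xx + u_yy, plus u, at the node, and the Laplacian is
    expanded to first order in a.  Substituting,

    - the terms without a factor h cancel because u is continuous across the
      interface;
    - the terms in h cancel because the flux is continuous and kappa* is the
      harmonic mean of the two coefficients;
    - u_yy has zero trace, and the terms in h^2 and h^3 that are left are the
      claimed ones.

    The two columns i = M and i = M+1 are mirror images: exchanging the sides
    and reversing the sign of a turns one computation into the other.  It is
    done once, for a near side, a far side and a sign, in [column_error].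

    The constant in the O-term must not depend on the grid.  It comes from a
    bound on the fourth derivatives over the whole open subdomain, which holds
    since these extend continuously to the compact closure
    ([bounded_of_limits]).  The derivatives exist only in the open subdomain,
    while the base point (1/2, y), and some stencil points, lie on its boundary.
    The expansion is therefore proved with all points in the interior
    ([pair_expansion_interior], [laplacian_expansion_interior]) and carried to
    the boundary by contracting the points towards the centre of the rectangle
    and passing to the limit ([pair_expansion_closed],
    [laplacian_expansion_closed]). *)

(** * Taylor remainder with a uniform bound *)

(** [Taylor_Lagrange] expands to the right of the base point only; to the left,
    it is applied to the reflected function [fun y => f (- y)]. *)
Lemma taylor_lagrange_bound (f : R -> R) (n : nat) (p q B x0 x : R) :
  (forall t, p < t < q -> forall k, (k <= S n)%nat -> ex_derive_n f k t) ->
  (forall t, p < t < q -> Rabs (Derive_n f (S n) t) <= B) ->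
  p < x0 < q -> p < x < q ->
  Rabs (f x - sum_f_R0 (fun m =>
    (x - x0) ^ m / INR (Factorial.fact m) * Derive_n f m x0) n)
  <= B * Rabs (x - x0) ^ S n.
Proof.
  intros Hd HB Hx0 Hx.
  enough (exists z, p < z < q /\
    f x = sum_f_R0 (fun m =>
            (x - x0) ^ m / INR (Factorial.fact m) * Derive_n f m x0) n
          + (x - x0) ^ S n / INR (Factorial.fact (S n)) * Derive_n f (S n) z)
    as (z & Hz & ->).
  { set (s := sum_f_R0 _ n).
    replace (s + _ - s) with
      (Derive_n f (S n) z * (x - x0) ^ S n * / INR (Factorial.fact (S n)))
      by (unfold Rdiv; ring).
    rewrite !Rabs_mult, <- RPow_abs.
    assert (Hf : 1 <= INR (Factorial.fact (S n))).
    { change 1 with (INR 1). apply le_INR, Factorial.lt_O_fact. }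
    assert (Hi : Rabs (/ INR (Factorial.fact (S n))) <= 1).
    { rewrite Rabs_pos_eq.
      - rewrite <- Rinv_1. apply Rinv_le_contravar; lra.
      - left. apply Rinv_0_lt_compat. lra. }
    rewrite <- (Rmult_1_r (B * _)).
    apply Rmult_le_compat; auto using Rabs_pos.
    - apply Rmult_le_pos; [apply Rabs_pos | apply pow_le, Rabs_pos].
    - apply Rmult_le_compat_r; [apply pow_le, Rabs_pos | apply HB, Hz]. }
  destruct (Rtotal_order x0 x) as [Hlt | [<- | Hgt]].
  - destruct (Taylor_Lagrange f n x0 x Hlt) as (z & Hz & E).
    + intros t Ht. apply Hd. lra.
    + exists z. split; [lra | exact E].
  - (* The remainder term vanishes, so that any point can serve as z. *)
    exists x0. split; [exact Hx0 |].
    rewrite Rminus_diag. rewrite pow_i by lia.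
    assert (E : forall m, sum_f_R0
      (fun m => 0 ^ m / INR (Factorial.fact m) * Derive_n f m x0) m = f x0).
    { induction m as [|m IH]; cbn [sum_f_R0].
      - simpl. field.
      - rewrite IH, pow_i by lia. unfold Rdiv. ring. }
    rewrite E. unfold Rdiv. ring.
  - assert (Hloc : forall t, p < t < q -> locally t (fun y =>
      forall k, (k <= S n)%nat -> ex_derive_n f k y)).
    { intros t Ht.
      apply filter_imp with (fun y => p < y /\ y < q).
      - intros y Hy. apply Hd. lra.
      - apply filter_and; [apply (open_gt p t) | apply (open_lt q t)]; lra. }
    assert (Hop : forall t, p < t < q -> forall k, (k <= S n)%nat ->
      Derive_n (fun y => f (- y)) k (- t) = (-1) ^ k * Derive_n f k t).
    { intros t Ht k Hk.
      rewrite Derive_n_comp_opp; rewrite Ropp_involutive; [reflexivity |].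
      generalize (Hloc t Ht). apply filter_imp.
      intros y Hy m Hm. apply Hy. lia. }
    destruct (Taylor_Lagrange (fun y => f (- y)) n (- x0) (- x)) as (z & Hz & E).
    + lra.
    + intros t Ht k Hk. apply ex_derive_n_comp_opp.
      generalize (Hloc (- t) ltac:(lra)). apply filter_imp.
      intros y Hy m Hm. apply Hy. lia.
    + exists (- z). split; [lra |].
      assert (Hs : forall k, (- x - - x0) ^ k * (-1) ^ k = (x - x0) ^ k).
      { intros k. rewrite <- Rpow_mult_distr. f_equal. ring. }
      rewrite Ropp_involutive in E. rewrite E. f_equal.
      * apply sum_eq. intros k Hk. rewrite Hop by (lra || lia).
        rewrite <- (Hs k). unfold Rdiv. ring.
      * rewrite <- (Ropp_involutive z) at 1.
        rewrite Hop by (lra || lia).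
        rewrite <- (Hs (S n)). unfold Rdiv. ring.
Qed.

(** * Functions of class C^k up to the boundary of a rectangle *)

(** Both subdomains of the interface problem are convertible to instances. *)
Definition rect (p q x y : R) : Prop := p < x < q /\ 0 < y < 1.
Definition rectbar (p q x y : R) : Prop := p <= x <= q /\ 0 <= y <= 1.

(** Near each point of the closure, [w] is bounded by the inverse of the radius
    of a small enough neighbourhood.  Compactness bounds the radii that are used
    from below by some [d], so [/ d] is a global bound: choosing a radius that
    also controls the size of [w] replaces the finite subcover. *)
Lemma bounded_of_limits (p q : R) (w : R -> R -> R) :
  (forall x y, rectbar p q x y -> exists l, lim_in (rect p q) w x y l) ->
  exists B, forall x y, rect p q x y -> Rabs (w x y) <= B.
Proof.
  intros Hlim.
  assert (Hdel : forall a b, exists d : posreal, rectbar p q a b ->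
    forall x y, rect p q x y -> Rabs (x - a) < d -> Rabs (y - b) < d ->
    Rabs (w x y) <= / d).
  { intros a b. destruct (classic (rectbar p q a b)) as [Hab | Hab].
    2: { exists (mkposreal 1 Rlt_0_1). tauto. }
    destruct (Hlim a b Hab) as (l & Hl).
    destruct (Hl (ball l 1)) as (e & He).
    { exists (mkposreal 1 Rlt_0_1). auto. }
    pose proof (Rabs_pos l) as Hl0.
    assert (H0 : 0 < / (Rabs l + 1)) by (apply Rinv_0_lt_compat; lra).
    assert (Hm : 0 < Rmin e (/ (Rabs l + 1)))
      by (apply Rmin_pos; [apply cond_pos | exact H0]).
    exists (mkposreal _ Hm). simpl. intros _ x y Hxy Hx Hy.
    assert (Hb : Rabs (w x y - l) < 1).
    { apply (He (x, y)); [| exact Hxy].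
      split; simpl.
      - exact (Rlt_le_trans _ _ _ Hx (Rmin_l _ _)).
      - exact (Rlt_le_trans _ _ _ Hy (Rmin_l _ _)). }
    apply Rle_trans with (/ / (Rabs l + 1)).
    - rewrite Rinv_inv.
      replace (w x y) with (l + (w x y - l)) by ring.
      apply Rle_trans with (1 := Rabs_triang _ _). lra.
    - apply Rinv_le_contravar; [exact Hm | apply Rmin_r]. }
  assert (Hdel' : forall a b, {d : posreal | rectbar p q a b ->
    forall x y, rect p q x y -> Rabs (x - a) < d -> Rabs (y - b) < d ->
    Rabs (w x y) <= / d}).
  { intros a b. apply constructive_indefinite_description, Hdel. }
  destruct (compactness_value_2d p q 0 1 (fun a b => proj1_sig (Hdel' a b)))
    as (d & Hd).
  exists (/ d). intros x y Hxy.
  destruct (NNPP _ (Hd x y ltac:(unfold rect in Hxy; lra)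
                           ltac:(unfold rect in Hxy; lra)))
    as (a & b & Ha & Hb & Hxa & Hyb & Hdd).
  apply Rle_trans with (/ proj1_sig (Hdel' a b)).
  - apply (proj2_sig (Hdel' a b)); trivial. split; assumption.
  - apply Rinv_le_contravar; [apply cond_pos | exact Hdd].
Qed.


Section Smooth.
Variables (k : nat) (p q : R) (u : R -> R -> R).
Hypothesis Hk : (4 <= k)%nat.
Hypothesis Hu : Ck_closure k (rect p q) (rectbar p q) u.

Lemma x_derivable m n x y : (m + n <= 4)%nat -> rect p q x y ->
  ex_derive_n (fun t => partial_derive 0 n u t y) m x.
Proof.
  intros Hmn Hxy. destruct m as [|m]; [exact I |].
  exact (ex_diff_n_ex_deriv_inf_1 k m n ltac:(lia) u x y (proj1 Hu x y Hxy)).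
Qed.

Lemma y_derivable n x y : (n <= 4)%nat -> rect p q x y ->
  ex_derive_n (fun t => u x t) n y.
Proof.
  intros Hn Hxy. destruct n as [|n]; [exact I |].
  exact (ex_diff_n_ex_deriv_inf_2 k 0 n ltac:(lia) u x y (proj1 Hu x y Hxy)).
Qed.

Lemma fourth_derivatives_bounded : exists B, 0 <= B /\ forall x y, rect p q x y ->
  Rabs (partial_derive 4 0 u x y) <= B /\
  Rabs (partial_derive 2 2 u x y) <= B /\
  Rabs (partial_derive 0 4 u x y) <= B.
Proof.
  assert (H : forall m n, (m + n <= k)%nat -> exists B, forall x y,
    rect p q x y -> Rabs (partial_derive m n u x y) <= B).
  { intros m n Hmn. apply bounded_of_limits.
    intros x y. apply (proj2 (proj2 Hu)), Hmn. }
  destruct (H 4%nat 0%nat) as (B1 & H1); [lia |].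
  destruct (H 2%nat 2%nat) as (B2 & H2); [lia |].
  destruct (H 0%nat 4%nat) as (B3 & H3); [lia |].
  exists (Rabs B1 + Rabs B2 + Rabs B3).
  pose proof (Rabs_pos B1). pose proof (Rabs_pos B2). pose proof (Rabs_pos B3).
  pose proof (RRle_abs B1). pose proof (RRle_abs B2). pose proof (RRle_abs B3).
  split; [lra |]. intros x y Hxy.
  specialize (H1 x y Hxy). specialize (H2 x y Hxy). specialize (H3 x y Hxy).
  lra.
Qed.

(** The Taylor polynomial of [u x (y + s) + u x (y - s)], where [a] is the
    distance from the base abscissa to [x] and [vmn] the mixed derivative of
    order (m, n) at the base point. *)
Definition pair_expansion (v0 v1 v2 v3 v02 v12 a s : R) : R :=
  2 * (v0 + a * v1 + a ^ 2 / 2 * v2 + a ^ 3 / 6 * v3)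
  + s ^ 2 * (v02 + a * v12).

(** Expand in y about (x, y) to order 3, then expand [u] to order 3 and [u_yy] to
    order 1 in x about (c, y).  Only derivatives of order 4 occur in the
    remainders, and the mixed product [s^2 a^2] is at most [a^4 + s^4]. *)
Lemma pair_expansion_interior : exists B, 0 <= B /\ forall c x y s,
  rect p q c y -> rect p q x (y - s) -> rect p q x (y + s) ->
  Rabs (u x (y + s) + u x (y - s)
        - pair_expansion (u c y) (partial_derive 1 0 u c y)
            (partial_derive 2 0 u c y) (partial_derive 3 0 u c y)
            (partial_derive 0 2 u c y) (partial_derive 1 2 u c y) (x - c) s)
  <= B * ((x - c) ^ 4 + s ^ 4).
Proof.
  destruct fourth_derivatives_bounded as (B & HB0 & HB).
  exists (3 * B). split; [lra |].
  intros c x y s Hc Hm Hp. unfold rect in Hc, Hm, Hp.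
  assert (Hy : forall z, 0 < z < 1 -> Rabs (u x z - sum_f_R0 (fun m =>
    (z - y) ^ m / INR (Factorial.fact m) * Derive_n (u x) m y) 3)
    <= B * Rabs (z - y) ^ 4).
  { intros z Hz. apply taylor_lagrange_bound with 0 1; try lra.
    - intros t Ht m Hmk. apply y_derivable; [lia | split; lra].
    - intros t Ht. apply (HB x t). split; lra. }
  assert (Hx0 := taylor_lagrange_bound (fun t => u t y) 3 p q B c x
    (fun t Ht m Hmk => x_derivable m 0 t y ltac:(lia) ltac:(split; lra))
    (fun t Ht => proj1 (HB t y ltac:(split; lra))) ltac:(lra) ltac:(lra)).
  assert (Hx2 := taylor_lagrange_bound (fun t => partial_derive 0 2 u t y) 1 p q B c x
    (fun t Ht m Hmk => x_derivable m 2 t y ltac:(lia) ltac:(split; lra))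
    (fun t Ht => proj1 (proj2 (HB t y ltac:(split; lra)))) ltac:(lra) ltac:(lra)).
  assert (Hyp := Hy (y + s) ltac:(lra)). assert (Hym := Hy (y - s) ltac:(lra)).
  clear Hy.
  replace (y + s - y) with s in Hyp by ring.
  replace (y - s - y) with (- s) in Hym by ring.
  rewrite Rabs_Ropp in Hym.
  assert (E4 : forall r, Rabs r ^ 4 = r ^ 4).
  { intros r. rewrite RPow_abs. apply Rabs_pos_eq.
    replace (r ^ 4) with ((r ^ 2) ^ 2) by ring. apply pow2_ge_0. }
  assert (E2 : forall r, Rabs r ^ 2 = r ^ 2).
  { intros r. rewrite RPow_abs. apply Rabs_pos_eq, pow2_ge_0. }
  rewrite E4 in Hyp, Hym, Hx0. rewrite E2 in Hx2. clear E4 E2.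
  change (Derive_n (u x)) with (fun m z => partial_derive 0 m u x z) in Hyp, Hym.
  change (Derive_n (fun t => u t y)) with (fun m z => partial_derive m 0 u z y) in Hx0.
  change (Derive_n (fun t => partial_derive 0 2 u t y))
    with (fun m z => partial_derive m 2 u z y) in Hx2.
  cbn [sum_f_R0 Factorial.fact Nat.mul Nat.add] in Hyp, Hym, Hx0, Hx2.
  change (partial_derive 0 0 u x y) with (u x y) in *.
  change (partial_derive 0 0 u c y) with (u c y) in *.
  set (d01 := partial_derive 0 1 u x y) in *.
  set (d02 := partial_derive 0 2 u x y) in *.
  set (d03 := partial_derive 0 3 u x y) in *.
  unfold pair_expansion.
  set (e10 := partial_derive 1 0 u c y) in *.
  set (e20 := partial_derive 2 0 u c y) in *.
  set (e30 := partial_derive 3 0 u c y) in *.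
  set (e02 := partial_derive 0 2 u c y) in *.
  set (e12 := partial_derive 1 2 u c y) in *.
  set (up := u x (y + s)) in *. set (um := u x (y - s)) in *.
  set (u0 := u x y) in *. set (v0 := u c y) in *.
  set (a := x - c) in *.
  match type of Hyp with Rabs ?r <= _ => set (r1 := r) in Hyp end.
  match type of Hym with Rabs ?r <= _ => set (r2 := r) in Hym end.
  match type of Hx0 with Rabs ?r <= _ => set (r3 := r) in Hx0 end.
  match type of Hx2 with Rabs ?r <= _ => set (r4 := r) in Hx2 end.
  assert (E : up + um - (2 * (v0 + a * e10 + a ^ 2 / 2 * e20 + a ^ 3 / 6 * e30)
    + s ^ 2 * (e02 + a * e12)) = r1 + r2 + 2 * r3 + s ^ 2 * r4).
  { unfold r1, r2, r3, r4. simpl. field. }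
  rewrite E. clearbody r1 r2 r3 r4. clear E.
  apply Rabs_le_between in Hyp, Hym, Hx0, Hx2. apply Rabs_le_between.
  pose proof (pow2_ge_0 s) as Hs. pose proof (pow2_ge_0 (a ^ 2 - s ^ 2)) as Has.
  nra.
Qed.

Lemma laplacian_expansion_interior : exists B, 0 <= B /\ forall c x y,
  rect p q c y -> rect p q x y ->
  Rabs (partial_derive 2 0 u x y + partial_derive 0 2 u x y
        - (partial_derive 2 0 u c y + partial_derive 0 2 u c y
           + (x - c) * (partial_derive 3 0 u c y + partial_derive 1 2 u c y)))
  <= B * (x - c) ^ 2.
Proof.
  destruct fourth_derivatives_bounded as (B & HB0 & HB).
  exists (2 * B). split; [lra |].
  intros c x y Hc Hx. unfold rect in Hc, Hx.
  assert (H2 := taylor_lagrange_bound (fun t => partial_derive 0 2 u t y) 1 p q B c x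
    (fun t Ht m Hmk => x_derivable m 2 t y ltac:(lia) ltac:(split; lra))
    (fun t Ht => proj1 (proj2 (HB t y ltac:(split; lra)))) ltac:(lra) ltac:(lra)).
  assert (Hcomp : forall m t, Derive_n (fun z => partial_derive 2 0 u z y) m t
                              = partial_derive (m + 2) 0 u t y).
  { intros m t. exact (Derive_n_comp (fun z => u z y) m 2 t). }
  assert (H0 : Rabs (partial_derive 2 0 u x y - sum_f_R0 (fun m =>
      (x - c) ^ m / INR (Factorial.fact m)
      * Derive_n (fun z => partial_derive 2 0 u z y) m c) 1)
    <= B * Rabs (x - c) ^ 2).
  { apply (taylor_lagrange_bound (fun z => partial_derive 2 0 u z y) 1 p q);
      try lra.
    - intros t Ht m Hm. destruct m as [|m]; [exact I |].
      apply ex_derive_ext with (fun z => partial_derive (m + 2) 0 u z y).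
      { intros z. symmetry. apply Hcomp. }
      replace (m + 2)%nat with (S (S m)) by lia.
      apply (x_derivable (S (S (S m))) 0); [lia | split; lra].
    - intros t Ht. rewrite Hcomp.
      exact (proj1 (HB t y ltac:(split; lra))). }
  cbn [sum_f_R0] in H0, H2. rewrite !Hcomp in H0. cbn [Nat.add] in H0.
  change (Derive_n (fun t => partial_derive 0 2 u t y))
    with (fun m z => partial_derive m 2 u z y) in H2.
  cbn beta in H2.
  rewrite RPow_abs, (Rabs_pos_eq _ (pow2_ge_0 _)) in H0, H2.
  match type of H0 with Rabs ?r <= _ => set (r0 := r) in H0 end.
  match type of H2 with Rabs ?r <= _ => set (r2 := r) in H2 end.
  replace (_ - _) with (r0 + r2) by (unfold r0, r2; simpl; field).
  apply Rle_trans with (1 := Rabs_triang _ _). lra.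
Qed.

(** * Passage to the boundary *)

(** Sequence going from [z] towards [m] and converging to [z].  It is affine in
    [z], so that it maps a point, its vertical translates and the base point of
    an expansion to points in the same relative position. *)
Definition contract (m z : R) (n : nat) : R := z + / (INR n + 2) * (m - z).

Lemma is_lim_seq_contract m z : is_lim_seq (contract m z) z.
Proof.
  unfold contract.
  replace (Finite z) with (Finite (z + 0 * (m - z))) by (f_equal; ring).
  apply is_lim_seq_plus'; [apply is_lim_seq_const |].
  apply is_lim_seq_mult'; [| apply is_lim_seq_const].
  replace (Finite 0) with (Rbar_inv p_infty) by reflexivity.
  apply is_lim_seq_inv; [| discriminate].
  apply is_lim_seq_plus with p_infty 2;
    [apply is_lim_seq_INR | apply is_lim_seq_const | reflexivity].
Qed.

Lemma contract_weight n : 0 < / (INR n + 2) < 1.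
Proof.
  pose proof (pos_INR n) as Hn. split.
  - apply Rinv_0_lt_compat. lra.
  - rewrite <- Rinv_1. apply Rinv_lt_contravar; lra.
Qed.

Lemma contract_inside a b z n : a < b -> a <= z <= b ->
  a < contract ((a + b) / 2) z n < b.
Proof.
  intros Hab Hz. pose proof (contract_weight n). unfold contract. nra.
Qed.

(** The midpoint of (0, 1) is written [(0 + 1) / 2] so that [contract_inside]
    unifies with both coordinates. *)
Lemma contract_rect x y n : p < q -> rectbar p q x y ->
  rect p q (contract ((p + q) / 2) x n) (contract ((0 + 1) / 2) y n).
Proof.
  intros Hpq [Hx Hy]. split; apply contract_inside; lra.
Qed.

Lemma lim_in_seq (D : R -> R -> Prop) (w : R -> R -> R) x y l (a b : nat -> R) :
  lim_in D w x y l -> (forall n, D (a n) (b n)) ->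
  is_lim_seq a x -> is_lim_seq b y -> is_lim_seq (fun n => w (a n) (b n)) l.
Proof.
  intros Hl HD Ha Hb.
  apply (filterlim_comp nat (R * R) R (fun n => (a n, b n))
    (fun z => w (fst z) (snd z)) eventually
    (within (fun z => D (fst z) (snd z)) (locally (x, y)))); [| exact Hl].
  intros P [e He].
  generalize (Ha (ball x e) (locally_ball x e)) (Hb (ball y e) (locally_ball y e)).
  unfold filtermap. intros Hx Hy.
  generalize (filter_and _ _ Hx Hy). apply filter_imp.
  intros n [Hxn Hyn]. apply He; [split; assumption | apply HD].
Qed.

Lemma lim_in_contract (w : R -> R -> R) x y l : p < q -> rectbar p q x y ->
  lim_in (rect p q) w x y l ->
  is_lim_seq (fun n => w (contract ((p + q) / 2) x n)
                         (contract ((0 + 1) / 2) y n)) l.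
Proof.
  intros Hpq Hxy Hl. apply (lim_in_seq _ _ _ _ _ _ _ Hl).
  - intros n. apply contract_rect; assumption.
  - apply is_lim_seq_contract.
  - apply is_lim_seq_contract.
Qed.

Lemma is_lim_seq_pow (a : nat -> R) (l : R) (m : nat) :
  is_lim_seq a l -> is_lim_seq (fun n => a n ^ m) (l ^ m).
Proof.
  intros Ha. induction m as [|m IH]; simpl.
  - apply is_lim_seq_const.
  - apply is_lim_seq_mult'; assumption.
Qed.

Ltac lim_arith :=
  repeat match goal with
  | H : is_lim_seq ?a ?l |- is_lim_seq ?a ?l => exact H
  | |- is_lim_seq (contract _ _) _ => apply is_lim_seq_contract
  | |- is_lim_seq (fun n => contract ?m ?z n) _ => exact (is_lim_seq_contract m z)
  | |- is_lim_seq (fun _ => ?c) _ => apply is_lim_seq_const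
  | |- is_lim_seq (fun n => Rabs _) (Finite (Rabs ?l)) =>
      apply (is_lim_seq_abs _ (Finite l))
  | |- is_lim_seq (fun n => _ + _) _ => apply is_lim_seq_plus'
  | |- is_lim_seq (fun n => _ - _) _ => apply is_lim_seq_minus'
  | |- is_lim_seq (fun n => _ * _) _ => apply is_lim_seq_mult'
  | |- is_lim_seq (fun n => _ / _) _ => apply is_lim_seq_mult'
  | |- is_lim_seq (fun n => _ ^ _) _ => apply is_lim_seq_pow
  end.

Lemma pair_expansion_closed : p < q -> exists B, 0 <= B /\
  forall c x y s v1 v2 v3 v02 v12,
  rectbar p q c y -> rectbar p q x (y - s) -> rectbar p q x (y + s) ->
  lim_in (rect p q) (partial_derive 1 0 u) c y v1 ->
  lim_in (rect p q) (partial_derive 2 0 u) c y v2 ->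
  lim_in (rect p q) (partial_derive 3 0 u) c y v3 ->
  lim_in (rect p q) (partial_derive 0 2 u) c y v02 ->
  lim_in (rect p q) (partial_derive 1 2 u) c y v12 ->
  Rabs (u x (y + s) + u x (y - s)
        - pair_expansion (u c y) v1 v2 v3 v02 v12 (x - c) s)
  <= B * ((x - c) ^ 4 + s ^ 4).
Proof.
  intros Hpq. destruct pair_expansion_interior as (B & HB0 & HB).
  exists B. split; [exact HB0 |].
  intros c x y s v1 v2 v3 v02 v12 Hc Hm Hp H1 H2 H3 H02 H12.
  apply (lim_in_contract _ _ _ _ Hpq Hc) in H1, H2, H3, H02, H12.
  pose proof (lim_in_contract _ _ _ _ Hpq Hc (proj1 (proj2 Hu) c y Hc)) as H0.
  pose proof (lim_in_contract _ _ _ _ Hpq Hm (proj1 (proj2 Hu) _ _ Hm)) as Hum.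
  pose proof (lim_in_contract _ _ _ _ Hpq Hp (proj1 (proj2 Hu) _ _ Hp)) as Hup.
  set (C := contract ((p + q) / 2)) in *. set (Y := contract ((0 + 1) / 2)) in *.
  (* Contracting y + s and y - s moves y and contracts s towards 0. *)
  set (sn := contract 0 s).
  assert (Hs : is_lim_seq sn s) by apply is_lim_seq_contract.
  assert (Es : forall n, Y (y + s) n = Y y n + sn n /\ Y (y - s) n = Y y n - sn n).
  { intros n. unfold Y, sn, contract. split; ring. }
  refine (is_lim_seq_le
    (fun n => Rabs (u (C x n) (Y (y + s) n) + u (C x n) (Y (y - s) n)
      - pair_expansion (u (C c n) (Y y n)) (partial_derive 1 0 u (C c n) (Y y n))
          (partial_derive 2 0 u (C c n) (Y y n)) (partial_derive 3 0 u (C c n) (Y y n))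
          (partial_derive 0 2 u (C c n) (Y y n)) (partial_derive 1 2 u (C c n) (Y y n))
          (C x n - C c n) (sn n)))
    (fun n => B * ((C x n - C c n) ^ 4 + sn n ^ 4)) (Finite _) (Finite _) _ _ _).
  - intros n. destruct (Es n) as [E1 E2].
    assert (Hp' := contract_rect _ _ n Hpq Hp).
    assert (Hm' := contract_rect _ _ n Hpq Hm).
    fold C Y in Hp', Hm'. rewrite E1 in *. rewrite E2 in *.
    apply HB; [| assumption | assumption].
    apply contract_rect; assumption.
  - unfold pair_expansion, C, Y in *. lim_arith.
  - unfold C. lim_arith.
Qed.

(** Only the base point moves here: the evaluation point stays in the open
    rectangle, where the equation holds. *)
Lemma laplacian_expansion_closed : p < q -> exists B, 0 <= B /\
  forall c x y v2 v3 v02 v12,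
  p <= c <= q -> rect p q x y ->
  lim_in (rect p q) (partial_derive 2 0 u) c y v2 ->
  lim_in (rect p q) (partial_derive 3 0 u) c y v3 ->
  lim_in (rect p q) (partial_derive 0 2 u) c y v02 ->
  lim_in (rect p q) (partial_derive 1 2 u) c y v12 ->
  Rabs (partial_derive 2 0 u x y + partial_derive 0 2 u x y
        - (v2 + v02 + (x - c) * (v3 + v12)))
  <= B * (x - c) ^ 2.
Proof.
  intros Hpq. destruct laplacian_expansion_interior as (B & HB0 & HB).
  exists B. split; [exact HB0 |].
  intros c x y v2 v3 v02 v12 Hc Hxy H2 H3 H02 H12.
  set (C := contract ((p + q) / 2) c).
  assert (HC : forall n, rect p q (C n) y).
  { intros n. split; [apply contract_inside; lra | apply Hxy]. }
  assert (HCl : is_lim_seq C c) by apply is_lim_seq_contract.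
  apply (fun H => lim_in_seq _ _ _ _ _ _ _ H HC HCl (is_lim_seq_const y))
    in H2, H3, H02, H12.
  refine (is_lim_seq_le
    (fun n => Rabs (partial_derive 2 0 u x y + partial_derive 0 2 u x y
        - (partial_derive 2 0 u (C n) y + partial_derive 0 2 u (C n) y
           + (x - C n) * (partial_derive 3 0 u (C n) y
                          + partial_derive 1 2 u (C n) y))))
    (fun n => B * (x - C n) ^ 2) (Finite _) (Finite _) _ _ _).
  - intros n. apply HB; [apply HC | exact Hxy].
  - lim_arith.
  - lim_arith.
Qed.

End Smooth.

(** * Traces on the interface *)

Lemma tr_l_unique z y l : is_tr_l z y l -> tr_l z y = l.
Proof.
  apply (iota_filterlim_locally (V := R_CompleteNormedModule)).
Qed.

Lemma tr_r_unique z y l : is_tr_r z y l -> tr_r z y = l.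
Proof.
  apply (iota_filterlim_locally (V := R_CompleteNormedModule)).
Qed.

Lemma lim_in_along_horizontal D w c y l (F : (R -> Prop) -> Prop) :
  Filter F -> F (fun x => D x y) -> filter_le F (locally c) ->
  lim_in D w c y l -> filterlim (fun x => w x y) F (locally l).
Proof.
  intros HF HD Hc Hl.
  apply (filterlim_comp R (R * R) R (fun x => (x, y))
    (fun z => w (fst z) (snd z)) F
    (within (fun z => D (fst z) (snd z)) (locally (c, y)))); [| exact Hl].
  intros P [e He]. unfold filtermap.
  generalize (filter_and _ _ HD (Hc _ (locally_ball c e))). apply filter_imp.
  intros x [Hx Hxc]. apply He; [| exact Hx].
  split; [exact Hxc | apply ball_center].
Qed.

Lemma at_left_rect p c y : p < c -> 0 < y < 1 ->
  at_left c (fun x => rect p c x y).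
Proof.
  intros Hp Hy. unfold at_left, within.
  generalize (open_gt p c Hp). apply filter_imp.
  intros x Hx Hxc. split; [lra | exact Hy].
Qed.

Lemma at_right_rect c q y : c < q -> 0 < y < 1 ->
  at_right c (fun x => rect c q x y).
Proof.
  intros Hq Hy. unfold at_right, within.
  generalize (open_lt q c Hq). apply filter_imp.
  intros x Hx Hxc. split; [lra | exact Hy].
Qed.

(** The limit at (1/2, y) over the whole subdomain, which exists by smoothness up
    to the boundary, restricts to the horizontal limit that defines the trace.
    The expansions use the former, the interface conditions the latter. *)
Lemma lim_in_tr_l k u m n y : Ck_closure k D1 D1bar u -> (m + n <= k)%nat ->
  0 < y < 1 ->
  is_tr_l (partial_derive m n u) y (tr_l (partial_derive m n u) y) /\
  lim_in D1 (partial_derive m n u) (1 / 2) y (tr_l (partial_derive m n u) y).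
Proof.
  intros Hu Hmn Hy.
  destruct (proj2 (proj2 Hu) m n (1 / 2) y Hmn) as (l & Hl).
  { split; lra. }
  assert (Hz : is_tr_l (partial_derive m n u) y l).
  { apply (lim_in_along_horizontal D1) with (c := 1 / 2); [apply _ | | | exact Hl].
    - apply at_left_rect; lra.
    - apply filter_le_within. }
  rewrite (tr_l_unique _ _ _ Hz). split; assumption.
Qed.

Lemma lim_in_tr_r k u m n y : Ck_closure k D2 D2bar u -> (m + n <= k)%nat ->
  0 < y < 1 ->
  is_tr_r (partial_derive m n u) y (tr_r (partial_derive m n u) y) /\
  lim_in D2 (partial_derive m n u) (1 / 2) y (tr_r (partial_derive m n u) y).
Proof.
  intros Hu Hmn Hy.
  destruct (proj2 (proj2 Hu) m n (1 / 2) y Hmn) as (l & Hl).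
  { split; lra. }
  assert (Hz : is_tr_r (partial_derive m n u) y l).
  { apply (lim_in_along_horizontal D2) with (c := 1 / 2); [apply _ | | | exact Hl].
    - apply at_right_rect; lra.
    - apply filter_le_within. }
  rewrite (tr_r_unique _ _ _ Hz). split; assumption.
Qed.

Lemma tr_l_kappa km z y l : is_tr_l z y l ->
  tr_l (fun s t => kappa km s t * z s t) y = km * l.
Proof.
  intros Hl. apply tr_l_unique.
  apply filterlim_ext_loc with (fun x => km * z x y).
  - unfold at_left, within. apply filter_forall. intros x Hx. unfold kappa.
    destruct (Rlt_dec x (1 / 2)); [reflexivity | contradiction].
  - apply (filterlim_comp _ _ _ (fun x => z x y) (Rmult km) _ (locally l));
      [exact Hl | apply (filterlim_scal_r km l)].
Qed.

Lemma tr_r_kappa km z y l : is_tr_r z y l ->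
  tr_r (fun s t => kappa km s t * z s t) y = l.
Proof.
  intros Hl. apply tr_r_unique.
  apply filterlim_ext_loc with (fun x => z x y); [| exact Hl].
  unfold at_right, within. apply filter_forall. intros x Hx. unfold kappa.
  destruct (Rlt_dec x (1 / 2)); [lra | ring].
Qed.

(** * The equation away from the interface *)

Lemma div_kappa_grad_const km u k x y :
  locally x (fun s => kappa km s y = k) ->
  div_kappa_grad km u x y
  = k * (partial_derive 2 0 u x y + partial_derive 0 2 u x y).
Proof.
  intros Hk. unfold div_kappa_grad. rewrite Rmult_plus_distr_l. f_equal.
  - change (Derive (fun s => kappa km s y * partial_derive 1 0 u s y) x
      = k * Derive (fun s => partial_derive 1 0 u s y) x).
    rewrite <- Derive_scal. apply Derive_ext_loc.
    generalize Hk. apply filter_imp. intros s ->. reflexivity.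
  - change (Derive (fun t => kappa km x t * partial_derive 0 1 u x t) y
      = k * Derive (fun t => partial_derive 0 1 u x t) y).
    rewrite <- Derive_scal. apply Derive_ext. intros t.
    rewrite <- (locally_singleton _ _ Hk). reflexivity.
Qed.

(** * The error in one column next to the interface *)

(** [n] marks the side of the node and [f] the opposite side; [sg] is 1 if the
    node is to the left of the interface and -1 if it is to the right.  [A], [B]
    are the pairs of stencil values on the near and far side, [C] the value at
    the node and [L] the Laplacian there.  The value [C] is expanded as a pair
    with s = 0, which is why it appears as [C2 = 2 * C].  The remainders add up
    to at most 97/32 kn + 17/32 ks + (kn + ks)/32 + kn/4 times [K h^4]. *)
Lemma column_error
  (kn kf ks sg h a b c v0 n1 n2 n3 n12 f1 f2 f3 f12 A B C2 C L K : R) :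
  0 < kn -> 0 < kf -> ks = 2 * kn * kf / (kn + kf) -> sg = 1 \/ sg = -1 ->
  kn * n1 = kf * f1 -> 0 <= K ->
  a = - (3 / 2 * sg * h) -> b = 1 / 2 * sg * h -> c = - (1 / 2 * sg * h) ->
  C2 = 2 * C ->
  Rabs (A - pair_expansion v0 n1 n2 n3 0 n12 a h) <= K * (a ^ 4 + h ^ 4) ->
  Rabs (B - pair_expansion v0 f1 f2 f3 0 f12 b h) <= K * (b ^ 4 + h ^ 4) ->
  Rabs (C2 - pair_expansion v0 n1 n2 n3 0 n12 c 0) <= K * (c ^ 4 + 0 ^ 4) ->
  Rabs (L - (n2 + 0 + c * (n3 + n12))) <= K * c ^ 2 ->
  Rabs (- (1 / 2) * kn * A - 1 / 2 * ks * B + (kn + ks + h ^ 2) * C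
        - h ^ 2 * (- (kn * L) + C)
        - (ks / 8 * (n2 - f2) * h ^ 2
           + sg * (kn / 24 * n3 - ks / 24 * ((n3 + f3) / 2)
                   + 1 / 4 * (kn * n12 - ks * f12)) * h ^ 3))
  <= 7 * (2 * kn + ks) * K * h ^ 4.
Proof.
  intros Hn Hf Hks Hsg Hflux HK Ha Hb Hc -> HA HB HC HL.
  assert (Hks0 : 0 < ks).
  { rewrite Hks. apply Rdiv_lt_0_compat; nra. }
  assert (Hsg2 : sg ^ 2 = 1) by (destruct Hsg as [-> | ->]; ring).
  assert (Hh4 : 0 <= K * h ^ 4).
  { apply Rmult_le_pos; [exact HK |].
    replace (h ^ 4) with ((h ^ 2) ^ 2) by ring. apply pow2_ge_0. }
  apply (Rmult_le_compat_l (h ^ 2)) in HL; [| apply pow2_ge_0].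
  rewrite <- (Rabs_pos_eq (h ^ 2)) in HL at 1 by apply pow2_ge_0.
  rewrite <- Rabs_mult in HL.
  replace (K * (a ^ 4 + h ^ 4)) with (97 / 16 * (K * h ^ 4)) in HA.
  2: { replace (a ^ 4) with (81 / 16 * (sg ^ 2) ^ 2 * h ^ 4) by (rewrite Ha; field).
       rewrite Hsg2. field. }
  replace (K * (b ^ 4 + h ^ 4)) with (17 / 16 * (K * h ^ 4)) in HB.
  2: { replace (b ^ 4) with (1 / 16 * (sg ^ 2) ^ 2 * h ^ 4) by (rewrite Hb; field).
       rewrite Hsg2. field. }
  replace (K * (c ^ 4 + 0 ^ 4)) with (1 / 16 * (K * h ^ 4)) in HC.
  2: { replace (c ^ 4) with (1 / 16 * (sg ^ 2) ^ 2 * h ^ 4) by (rewrite Hc; field).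
       rewrite Hsg2. field. }
  replace (h ^ 2 * (K * c ^ 2)) with (1 / 4 * (K * h ^ 4)) in HL.
  2: { replace (c ^ 2) with (1 / 4 * sg ^ 2 * h ^ 2) by (rewrite Hc; field).
       rewrite Hsg2. field. }
  match type of HA with Rabs ?r <= _ => set (rA := r) in HA end.
  match type of HB with Rabs ?r <= _ => set (rB := r) in HB end.
  match type of HC with Rabs ?r <= _ => set (rC := r) in HC end.
  match type of HL with Rabs ?r <= _ => set (rL := r) in HL end.
  match goal with |- Rabs ?r <= _ => replace r with
    (- (kn * rA / 2) + - (ks * rB / 2) + (kn + ks) * rC / 2 + kn * rL) end.
  (* All other terms cancel: the flux condition eliminates f1, and the value of
     ks makes the coefficient of n1 vanish. *)
  2: { unfold rA, rB, rC, rL, pair_expansion.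
       replace f1 with (kn * n1 / kf) by (rewrite Hflux; field; lra).
       rewrite Ha, Hb, Hc, Hks. destruct Hsg as [-> | ->]; field; lra. }
  clearbody rA rB rC rL.
  replace (7 * (2 * kn + ks) * K * h ^ 4) with (7 * (2 * kn + ks) * (K * h ^ 4))
    by ring.
  set (X := K * h ^ 4) in *. clearbody X.
  apply Rabs_le_between in HA, HB, HC, HL. apply Rabs_le_between. nra.
Qed.

(** * Nodes and coefficients of the scheme *)

Lemma node_S M k : node M (k + 1) = node M k + gridh M.
Proof. unfold node. rewrite plus_INR. simpl. ring. Qed.

Lemma node_pred M k : (1 <= k)%nat -> node M (k - 1) = node M k - gridh M.
Proof.
  intros Hk. replace k with (k - 1 + 1)%nat at 2 by lia. rewrite node_S. ring.
Qed.

Lemma gridh_mult M : INR (gridN M) * gridh M = 1.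
Proof.
  unfold gridh. apply Rinv_r, not_0_INR. unfold gridN. lia.
Qed.

Lemma gridh_bounds M : (1 <= M)%nat -> 0 < gridh M <= 1 / 3.
Proof.
  intros HM. assert (H := gridh_mult M).
  assert (H3 : 3 <= INR (gridN M)).
  { replace 3 with (INR 3) by (simpl; ring). apply le_INR. unfold gridN. lia. }
  assert (0 < gridh M).
  { apply Rinv_0_lt_compat. lra. }
  nra.
Qed.

Lemma node_interface M : node M M = 1 / 2 - gridh M / 2.
Proof.
  assert (H := gridh_mult M). unfold node.
  unfold gridN in H at 1. rewrite plus_INR, mult_INR in H. simpl in H. lra.
Qed.

Lemma node_bounds M j : (1 <= j <= gridN M - 1)%nat ->
  gridh M <= node M j <= 1 - gridh M.
Proof.
  intros Hj. assert (H := gridh_mult M).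
  assert (Hh : 0 < gridh M).
  { apply Rinv_0_lt_compat, lt_0_INR. unfold gridN. lia. }
  assert (H1 : 1 <= INR j) by (apply (le_INR 1); lia).
  assert (H2 : INR j + 1 <= INR (gridN M)).
  { rewrite <- S_INR. apply le_INR. lia. }
  unfold node. nra.
Qed.

Lemma between_spec a k b : between a k b = true <-> (a <= k <= b)%nat.
Proof.
  unfold between. rewrite andb_true_iff, !Nat.leb_le. reflexivity.
Qed.

Lemma coeffs_left km ks M j : (1 <= M)%nat -> between 1 j (gridN M - 1) = true ->
  coeffs km ks M M j
  = Stencil (- (1/2) * km) (- (1/2) * ks) (km + ks + gridh M ^ 2)
            (- (1/2) * km) (- (1/2) * ks).
Proof.
  intros HM Hj. unfold coeffs, S1I, S1B. rewrite Hj, Nat.eqb_refl.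
  destruct (between 1 M (M - 1)) eqn:E; [| reflexivity].
  apply between_spec in E. lia.
Qed.

Lemma coeffs_right km ks M j : (1 <= M)%nat -> between 1 j (gridN M - 1) = true ->
  coeffs km ks M (M + 1) j
  = Stencil (- (1/2) * ks) (- (1/2)) (ks + 1 + gridh M ^ 2)
            (- (1/2) * ks) (- (1/2)).
Proof.
  intros HM Hj. unfold coeffs, S1I, S1B, S2B. rewrite Hj, Nat.eqb_refl.
  destruct (between 1 (M + 1) (M - 1)) eqn:E; [apply between_spec in E; lia |].
  destruct (Nat.eqb_spec (M + 1) M) as [E' | E']; [lia | reflexivity].
Qed.

(** * The truncation error *)

Theorem corollary3p1 (km ks : R) (f u : R -> R -> R)
  (hkm : 1 <= km)
  (hu : exact_solution km f u)
  (hW : W u)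
  (hks : ks = 2 * km / (km + 1))
  (hyy : forall y : R, 0 < y < 1 ->
     is_tr_l (partial_derive 0 2 u) y 0 /\
     is_tr_r (partial_derive 0 2 u) y 0) :
  exists K : R, forall M i j : nat, (1 <= M)%nat -> SB M i j = true ->
    Rabs (trunc_err km ks f u M i j
          - (C2 ks u M i (node M j) * gridh M ^ 2
             + C3 km ks u M i (node M j) * gridh M ^ 3))
    <= K * gridh M ^ 4.
Proof.
  destruct hu as (Hpde & _ & Hjump). destruct hW as [HW1 HW2].
  destruct (pair_expansion_closed 6 0 (1 / 2) u ltac:(lia) HW1 ltac:(lra))
    as (B1 & HB1 & E1).
  destruct (pair_expansion_closed 6 (1 / 2) 1 u ltac:(lia) HW2 ltac:(lra))
    as (B2 & HB2 & E2).
  destruct (laplacian_expansion_closed 6 0 (1 / 2) u ltac:(lia) HW1 ltac:(lra))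
    as (B3 & HB3 & E3).
  destruct (laplacian_expansion_closed 6 (1 / 2) 1 u ltac:(lia) HW2 ltac:(lra))
    as (B4 & HB4 & E4).
  set (K := B1 + B2 + B3 + B4).
  exists (7 * (2 * km + 2 + ks) * K).
  intros M i j HM Hij.
  assert (Hj : between 1 j (gridN M - 1) = true).
  { unfold SB, S1B, S2B in Hij. destruct (between 1 j (gridN M - 1)); [reflexivity |].
    rewrite !andb_false_r in Hij. discriminate. }
  assert (Hj' := proj1 (between_spec _ _ _) Hj).
  assert (Hh := gridh_bounds M HM). assert (Hy := node_bounds M j Hj').
  assert (HxM := node_interface M). assert (HxM1 := node_S M M).
  set (h := gridh M) in *. set (y := node M j) in *.
  assert (Hy01 : 0 < y < 1) by lra.
  assert (Hh4 : 0 <= h ^ 4) by (apply pow_le; lra).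
  set (l m n := tr_l (partial_derive m n u) y).
  set (r m n := tr_r (partial_derive m n u) y).
  assert (Tl : forall m n, (m + n <= 6)%nat ->
    is_tr_l (partial_derive m n u) y (l m n) /\
    lim_in D1 (partial_derive m n u) (1 / 2) y (l m n)).
  { intros m n Hmn. exact (lim_in_tr_l 6 u m n y HW1 Hmn Hy01). }
  assert (Tr : forall m n, (m + n <= 6)%nat ->
    is_tr_r (partial_derive m n u) y (r m n) /\
    lim_in D2 (partial_derive m n u) (1 / 2) y (r m n)).
  { intros m n Hmn. exact (lim_in_tr_r 6 u m n y HW2 Hmn Hy01). }
  assert (Hl02 : l 0%nat 2%nat = 0) by exact (tr_l_unique _ _ _ (proj1 (hyy y Hy01))).
  assert (Hr02 : r 0%nat 2%nat = 0) by exact (tr_r_unique _ _ _ (proj2 (hyy y Hy01))).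
  assert (Hflux : km * l 1%nat 0%nat = r 1%nat 0%nat).
  { generalize (proj2 (Hjump y Hy01)). unfold jump.
    rewrite (tr_l_kappa _ _ _ _ (proj1 (Tl 1%nat 0%nat ltac:(lia)))).
    rewrite (tr_r_kappa _ _ _ _ (proj1 (Tr 1%nat 0%nat ltac:(lia)))). lra. }
  assert (Hsum : forall a s, 0 <= a ^ 4 + s ^ 4).
  { intros a s. replace (a ^ 4 + s ^ 4) with ((a ^ 2) ^ 2 + (s ^ 2) ^ 2) by ring.
    pose proof (pow2_ge_0 (a ^ 2)). pose proof (pow2_ge_0 (s ^ 2)). lra. }
  assert (P1 : forall x s, 0 <= x <= 1 / 2 -> 0 <= s <= h ->
    Rabs (u x (y + s) + u x (y - s) - pair_expansion (u (1 / 2) y) (l 1%nat 0%nat)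
      (l 2%nat 0%nat) (l 3%nat 0%nat) 0 (l 1%nat 2%nat) (x - 1 / 2) s)
    <= K * ((x - 1 / 2) ^ 4 + s ^ 4)).
  { intros x s Hx Hs. rewrite <- Hl02.
    apply Rle_trans with (B1 * ((x - 1 / 2) ^ 4 + s ^ 4)).
    - apply E1; try (split; lra); apply Tl; lia.
    - apply Rmult_le_compat_r; [apply Hsum | unfold K; lra]. }
  assert (P2 : forall x s, 1 / 2 <= x <= 1 -> 0 <= s <= h ->
    Rabs (u x (y + s) + u x (y - s) - pair_expansion (u (1 / 2) y) (r 1%nat 0%nat)
      (r 2%nat 0%nat) (r 3%nat 0%nat) 0 (r 1%nat 2%nat) (x - 1 / 2) s)
    <= K * ((x - 1 / 2) ^ 4 + s ^ 4)).
  { intros x s Hx Hs. rewrite <- Hr02.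
    apply Rle_trans with (B2 * ((x - 1 / 2) ^ 4 + s ^ 4)).
    - apply E2; try (split; lra); apply Tr; lia.
    - apply Rmult_le_compat_r; [apply Hsum | unfold K; lra]. }
  assert (Hks0 : 0 < ks) by (rewrite hks; apply Rdiv_lt_0_compat; lra).
  assert (HK : 0 <= K) by (unfold K; lra).
  assert (Hcases : i = M \/ i = (M + 1)%nat).
  { unfold SB, S1B, S2B in Hij.
    destruct (Nat.eqb_spec i M), (Nat.eqb_spec i (M + 1)); auto; discriminate. }
  clear Hij. unfold trunc_err, Lh, C2, C3.
  destruct Hcases as [-> | ->].
  - rewrite coeffs_left by assumption. rewrite Nat.eqb_refl. cbn [a1 a2 a3 a4 a5].
    rewrite !node_pred, !node_S by lia. fold h y. rewrite HxM.
    assert (HD : D1 (1 / 2 - h / 2) y) by (split; lra).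
    rewrite <- (Hpde _ _ (or_introl HD)).
    rewrite (div_kappa_grad_const km u km).
    2: { generalize (open_lt (1 / 2) (1 / 2 - h / 2) ltac:(lra)). apply filter_imp.
         intros s Hs. unfold kappa. destruct (Rlt_dec s (1 / 2)); lra. }
    apply Rle_trans with (7 * (2 * km + ks) * K * h ^ 4).
    2: { apply Rmult_le_compat_r; [exact Hh4 |].
         apply Rmult_le_compat_r; [exact HK | lra]. }
    assert (PL := E3 (1 / 2) _ y _ _ _ _ ltac:(lra) HD
      (proj2 (Tl 2%nat 0%nat ltac:(lia))) (proj2 (Tl 3%nat 0%nat ltac:(lia)))
      (proj2 (Tl 0%nat 2%nat ltac:(lia))) (proj2 (Tl 1%nat 2%nat ltac:(lia)))).
    rewrite Hl02 in PL.
    (* Near pair, far pair, and the node itself as a pair with s = 0. *)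
    refine (Rle_trans _ _ _ (Req_le _ _ (f_equal Rabs _))
      (column_error km 1 ks 1 h _ _ _ _ _ _ _ _ _ _ _ _ _ _ _
        (u (1 / 2 - h / 2) y) _ K _ _ _ _ _ HK _ _ _ _
        (P1 (1 / 2 - h / 2 - h) h _ _) (P2 (1 / 2 - h / 2 + h) h _ _)
        (P1 (1 / 2 - h / 2) 0 _ _)
        (Rle_trans _ _ _ PL (Rmult_le_compat_r _ _ _ (pow2_ge_0 _) _))));
      try lra.
    + unfold C2_M, C3_M, jump, mean. fold (l 2%nat 0%nat) (l 3%nat 0%nat)
        (l 1%nat 2%nat) (r 2%nat 0%nat) (r 3%nat 0%nat) (r 1%nat 2%nat). field.
    + rewrite Rplus_0_r, Rminus_0_r. ring.
    + unfold K. lra.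
  - rewrite coeffs_right by assumption. cbn [a1 a2 a3 a4 a5].
    destruct (Nat.eqb_spec (M + 1) M) as [E' | _]; [lia |].
    replace (M + 1 - 1)%nat with M by lia.
    rewrite !node_pred, !node_S by lia. fold h y. rewrite HxM.
    assert (HD : D2 (1 / 2 - h / 2 + h) y) by (split; lra).
    rewrite <- (Hpde _ _ (or_intror HD)).
    rewrite (div_kappa_grad_const km u 1).
    2: { generalize (open_gt (1 / 2) (1 / 2 - h / 2 + h) ltac:(lra)).
         apply filter_imp.
         intros s Hs. unfold kappa. destruct (Rlt_dec s (1 / 2)); lra. }
    apply Rle_trans with (7 * (2 * 1 + ks) * K * h ^ 4).
    2: { apply Rmult_le_compat_r; [exact Hh4 |].
         apply Rmult_le_compat_r; [exact HK | lra]. }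
    assert (PL := E4 (1 / 2) _ y _ _ _ _ ltac:(lra) HD
      (proj2 (Tr 2%nat 0%nat ltac:(lia))) (proj2 (Tr 3%nat 0%nat ltac:(lia)))
      (proj2 (Tr 0%nat 2%nat ltac:(lia))) (proj2 (Tr 1%nat 2%nat ltac:(lia)))).
    rewrite Hr02 in PL.
    refine (Rle_trans _ _ _ (Req_le _ _ (f_equal Rabs _))
      (column_error 1 km ks (-1) h _ _ _ _ _ _ _ _ _ _ _ _ _ _ _
        (u (1 / 2 - h / 2 + h) y) _ K _ _ _ _ _ HK _ _ _ _
        (P2 (1 / 2 - h / 2 + h + h) h _ _) (P1 (1 / 2 - h / 2) h _ _)
        (P2 (1 / 2 - h / 2 + h) 0 _ _)
        (Rle_trans _ _ _ PL (Rmult_le_compat_r _ _ _ (pow2_ge_0 _) _))));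
      try lra.
    + unfold C2_M1, C2_M, C3_M1, jump, mean. fold (l 2%nat 0%nat) (l 3%nat 0%nat)
        (l 1%nat 2%nat) (r 2%nat 0%nat) (r 3%nat 0%nat) (r 1%nat 2%nat). field.
    + rewrite hks. field. lra.
    + rewrite Rplus_0_r, Rminus_0_r. ring.
    + unfold K. lra.
Qed.
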